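(* For all integers $p,q\ge 0$ with $p+q\le 7$, the real geometric algebra $\mathbb{G}_{p,q}$ is isomorphic, as a unital associative $\mathbb{R}$-algebra, to the matrix algebra given in the following list: \begin{itemize} \item $p+q=0$: $\mathbb{G}_{0,0}\cong\mathbb{R}$. \item $p+q=1$: $\mathbb{G}_{1,0}\cong{}^2\mathbb{R}$, $\mathbb{G}_{0,1}\cong\mathbb{C}$. \item $p+q=2$: $\mathbb{G}_{2,0}\cong M_2(\mathbb{R})$, $\mathbb{G}_{1,1}\cong M_2(\mathbb{R})$, $\mathbb{G}_{0,2}\cong\mathbb{H}$. \item $p+q=3$: $\mathbb{G}_{3,0}\cong M_2(\mathbb{C})$, $\mathbb{G}_{2,1}\cong M_2({}^2\mathbb{R})$, $\mathbb{G}_{1,2}\cong M_2(\mathbb{C})$, $\mathbb{G}_{0,3}\cong{}^2\mathbb{H}$. \item $p+q=4$: $\mathbb{G}_{4,0}\cong M_2(\mathbb{H})$, $\mathbb{G}_{3,1}\cong M_4(\mathbb{R})$, $\mathbb{G}_{2,2}\cong M_4(\mathbb{R})$, $\mathbb{G}_{1,3}\cong M_2(\mathbb{H})$, $\mathbb{G}_{0,4}\cong M_2(\mathbb{H})$. \item $p+q=5$: $\mathbb{G}_{5,0}\cong M_2({}^2\mathbb{H})$, $\mathbb{G}_{4,1}\cong M_4(\mathbb{C})$, $\mathbb{G}_{3,2}\cong M_4({}^2\mathbb{R})$, $\mathbb{G}_{2,3}\cong M_4(\mathbb{C})$, $\mathbb{G}_{1,4}\cong M_2({}^2\mathbb{H})$,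 $\mathbb{G}_{0,5}\cong M_4(\mathbb{C})$. \item $p+q=6$: $\mathbb{G}_{6,0}\cong M_4(\mathbb{H})$, $\mathbb{G}_{5,1}\cong M_4(\mathbb{H})$, $\mathbb{G}_{4,2}\cong M_8(\mathbb{R})$, $\mathbb{G}_{3,3}\cong M_8(\mathbb{R})$, $\mathbb{G}_{2,4}\cong M_4(\mathbb{H})$, $\mathbb{G}_{1,5}\cong M_4(\mathbb{H})$, $\mathbb{G}_{0,6}\cong M_8(\mathbb{R})$. \item $p+q=7$: $\mathbb{G}_{7,0}\cong M_8(\mathbb{C})$, $\mathbb{G}_{6,1}\cong M_4({}^2\mathbb{H})$, $\mathbb{G}_{5,2}\cong M_8(\mathbb{C})$, $\mathbb{G}_{4,3}\cong M_8({}^2\mathbb{R})$, $\mathbb{G}_{3,4}\cong M_8(\mathbb{C})$, $\mathbb{G}_{2,5}\cong M_4({}^2\mathbb{H})$, $\mathbb{G}_{1,6}\cong M_8(\mathbb{C})$, $\mathbb{G}_{0,7}\cong M_8({}^2\mathbb{R})$. \end{itemize} Moreover, for all such $p,q$, the square of the pseudoscalar $i=e_1\cdots e_p f_1\cdots f_q$ of $\mathbb{G}_{p,q}$ is $+1$ or $-1$, with sign depending only on $p-q$ as follows: \begin{itemize} \item $i^2=+1$ if $p-q\in\{5,4,1,0,-3,-4,-7\}$; \item $i^2=-1$ if $p-q\in\{7,6,3,2,-1,-2,-5,-6\}$. \end{itemize}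
   Context: For integers $p,q\ge 0$, the real geometric (Clifford) algebra $\mathbb{G}_{p,q}=\mathbb{R}(e_1,\dots,e_p,f_1,\dots,f_q)$ is the universal unital associative $\mathbb{R}$-algebra generated by elements $e_1,\dots,e_p,f_1,\dots,f_q$ which pairwise anticommute (any two distinct generators $x,y$ satisfy $xy=-yx$) and satisfy $e_i^2=1$ for $1\le i\le p$ and $f_j^2=-1$ for $1\le j\le q$, with no further relations; it has dimension $2^{p+q}$ over $\mathbb{R}$. Its pseudoscalar is the element of highest grade, the product $e_1\cdots e_p f_1\cdots f_q$ of all the generators (equal to $1$ when $p=q=0$). Here $\mathbb{H}$ denotes Hamilton's real quaternion algebra. For an $\mathbb{R}$-algebra $A$, the double algebra is ${}^2A:=A\times A$ with componentwise addition and multiplication, and $M_m(A)$ is the algebra of $m\times m$ matrices with entries in $A$. *)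

(* Defs.v *)
From HB Require Import structures.
From mathcomp Require Import all_boot all_order all_algebra ring_quotient.
From mathcomp Require Import boolp reals complex.
From mathcomp Require Import ring.
From mathcomp Require Import finmap.
From mathcomp.multinomials Require Import monalg.

Set Implicit Arguments.
Unset Strict Implicit.
Unset Printing Implicit Defensive.

Import Order.TTheory GRing.Theory Num.Theory.

Local Open Scope ring_scope.
Local Open Scope quotient_scope.

Definition alg_isom (R : pzRingType) (A B : algType R) : Prop :=
  exists phi : {lrmorphism A -> B}, bijective phi.

Notation "A ≅ B" := (alg_isom A B) (at level 70, no associativity).

Fact malg_scalerAr (R : comNzRingType) (K : monomType) (c : R)
  (x y : {malg R[K]}) : c *: (x * y) = x * (c *: y).
Proof.
rewrite [x * y]malgME [RHS](malgMEw (fsubset_refl _) (msuppZ_le c y)).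
rewrite scaler_sumr; apply: eq_bigr => k _.
rewrite scaler_sumr; apply: eq_bigr => l _.
by apply/malgP => m; rewrite !(mcoeffZ, mcoeffU) mulrnAr mulrCA.
Qed.

Definition freeAlg (R : comNzRingType) (I : choiceType) : Type :=
  {malg R[{fmonom I}]}.

HB.instance Definition _ (R : comNzRingType) (I : choiceType) :=
  GRing.Lalgebra.on (freeAlg R I).

Section FreeAlg.
Variables (R : comNzRingType) (I : choiceType).

HB.instance Definition _ :=
  GRing.Lalgebra_isAlgebra.Build R (freeAlg R I) (@malg_scalerAr R {fmonom I}).

Definition freeGen (x : I) : freeAlg R I := << fmu x >>.

Section Lift.
Variables (B : algType R) (g : I -> B).

Definition fmon_eval (m : {fmonom I}) : B := \prod_(x <- (m : seq I)) g x.

Lemma fmon_eval_mmorphism : mmorphism fmon_eval.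
Proof.
split=> [m1 m2|]; rewrite /fmon_eval; last by rewrite fm1 big_nil.
by rewrite fmM big_cat.
Qed.

HB.instance Definition _ :=
  isMultiplicative.Build {fmonom I} B fmon_eval fmon_eval_mmorphism.

Definition freeLift (a : freeAlg R I) : B := mmap (in_alg B) fmon_eval a.

Fact freeLift_is_zmod_morphism : zmod_morphism freeLift.
Proof. by move=> a b; rewrite /freeLift raddfB. Qed.

HB.instance Definition _ :=
  GRing.isZmodMorphism.Build (freeAlg R I) B freeLift freeLift_is_zmod_morphism.

Fact freeLift_is_monoid_morphism : monoid_morphism freeLift.
Proof.
have [fM f1] := @commr_mmap_is_multiplicative
  _ _ _ (in_alg B : {rmorphism _ -> _}) fmon_eval
  (fun a m m' => comm_alg _ _).
by split=> // a b; exact: fM.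
Qed.

HB.instance Definition _ :=
  GRing.isMonoidMorphism.Build (freeAlg R I) B freeLift
    freeLift_is_monoid_morphism.

Fact freeLift_is_scalable : scalable freeLift.
Proof. by move=> c a; rewrite /freeLift mmapZ -mulr_algl. Qed.

HB.instance Definition _ :=
  GRing.isScalable.Build R (freeAlg R I) B *:%R freeLift freeLift_is_scalable.

Lemma freeLift_gen x : freeLift (freeGen x) = g x.
Proof.
by rewrite /freeLift mmapU /fmon_eval fmU big_seq1 /= scale1r mul1r.
Qed.

End Lift.
End FreeAlg.

Inductive ideal_of (A : nzRingType) (S : A -> Prop) : A -> Prop :=
| ideal_of_0 : ideal_of S 0
| ideal_of_gen a : S a -> ideal_of S a
| ideal_of_add a b : ideal_of S a -> ideal_of S b -> ideal_of S (a + b)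
| ideal_of_mul x a y : ideal_of S a -> ideal_of S (x * a * y).

Section Presented.
Variables (R : comNzRingType) (A : algType R) (S : A -> Prop).

Definition ideal_pred : {pred A} := fun a => `[< ideal_of S a >].

Lemma ideal_predP a : reflect (ideal_of S a) (a \in ideal_pred).
Proof. exact: asboolP. Qed.

Fact ideal_pred_zmod_closed : zmod_closed ideal_pred.
Proof.
split=> [|a b /ideal_predP Ia /ideal_predP Ib]; apply/ideal_predP.
  exact: ideal_of_0.
apply: ideal_of_add => //; rewrite -mulN1r -[-1 * b]mulr1.
exact: ideal_of_mul.
Qed.

HB.instance Definition _ := GRing.isZmodClosed.Build A ideal_pred
  ideal_pred_zmod_closed.


(* The proof of properness only serves to make 1 != 0 in the quotient. *)
Definition quotAlg (proper : ~ ideal_of S 1) : Type := (Quotient.quot ideal_pred).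

Variable proper : ~ ideal_of S 1.
Local Notation Q := (quotAlg proper).

HB.instance Definition _ := GRing.Zmodule.copy Q (Quotient.quot ideal_pred).

Definition quotPi (a : A) : Q := \pi_(Quotient.quot ideal_pred) a.
Definition quotRepr (x : Q) : A := repr (x : (Quotient.quot ideal_pred)).

Lemma quotReprK : cancel quotRepr quotPi.
Proof. exact: reprK. Qed.

Lemma quotPi_eq a b : quotPi a = quotPi b <-> ideal_of S (a - b).
Proof.
split=> [/eqP|/ideal_predP]; rewrite /quotPi.
  by rewrite -Quotient.idealrBE => /ideal_predP.
by rewrite Quotient.idealrBE => /eqP.
Qed.

Lemma ideal_ofB_repr a : ideal_of S (a - quotRepr (quotPi a)).
Proof. by apply/quotPi_eq; rewrite quotReprK. Qed.

Fact quotPi_is_zmod_morphism : zmod_morphism quotPi.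
Proof. by move=> a b; rewrite /quotPi raddfB. Qed.

HB.instance Definition _ :=
  GRing.isZmodMorphism.Build A Q quotPi quotPi_is_zmod_morphism.

Definition quot_one : Q := quotPi 1.
Definition quot_mul (x y : Q) : Q := quotPi (quotRepr x * quotRepr y).
Definition quot_scale (c : R) (x : Q) : Q := quotPi (c *: quotRepr x).

Lemma quotPiM a b : quot_mul (quotPi a) (quotPi b) = quotPi (a * b).
Proof.
apply/esym/quotPi_eq; set a' := quotRepr _; set b' := quotRepr _.
have -> : a * b - a' * b' = 1 * (a - a') * b + a' * (b - b') * 1.
  by rewrite mul1r mulr1 mulrBl mulrBr addrA subrK.
by apply: ideal_of_add; apply: ideal_of_mul; apply: ideal_ofB_repr.
Qed.

Lemma quotPiZ c a : quot_scale c (quotPi a) = quotPi (c *: a).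
Proof.
apply/esym/quotPi_eq; rewrite -scalerBr -mulr_algl -[X in ideal_of _ X]mulr1.
by apply: ideal_of_mul; apply: ideal_ofB_repr.
Qed.

Fact quot_mulA : associative quot_mul.
Proof.
move=> x y z; rewrite -[x]quotReprK -[y]quotReprK -[z]quotReprK.
by rewrite !quotPiM mulrA.
Qed.

Fact quot_mul1l : left_id quot_one quot_mul.
Proof. by move=> x; rewrite -[x]quotReprK quotPiM mul1r. Qed.

Fact quot_mul1r : right_id quot_one quot_mul.
Proof. by move=> x; rewrite -[x]quotReprK quotPiM mulr1. Qed.

Fact quot_mulDl : left_distributive quot_mul +%R.
Proof.
move=> x y z; rewrite -[x]quotReprK -[y]quotReprK -[z]quotReprK.
by rewrite -raddfD !quotPiM -raddfD mulrDl.
Qed.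

Fact quot_mulDr : right_distributive quot_mul +%R.
Proof.
move=> x y z; rewrite -[x]quotReprK -[y]quotReprK -[z]quotReprK.
by rewrite -raddfD !quotPiM -raddfD mulrDr.
Qed.

Fact quot_one_neq0 : quot_one != 0.
Proof.
apply/eqP; rewrite -[0](raddf0 quotPi) => /quotPi_eq.
by rewrite subr0.
Qed.

HB.instance Definition _ := GRing.Zmodule_isNzRing.Build Q
  quot_mulA quot_mul1l quot_mul1r quot_mulDl quot_mulDr quot_one_neq0.

Fact quotPi_is_monoid_morphism : monoid_morphism quotPi.
Proof. by split=> // a b; rewrite -quotPiM. Qed.

HB.instance Definition _ :=
  GRing.isMonoidMorphism.Build A Q quotPi quotPi_is_monoid_morphism.

Fact quot_scaleA a b x : quot_scale a (quot_scale b x) = quot_scale (a * b) x.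
Proof. by rewrite -[x]quotReprK !quotPiZ scalerA. Qed.

Fact quot_scale1 : left_id 1 quot_scale.
Proof. by move=> x; rewrite -[x]quotReprK !quotPiZ scale1r. Qed.

Fact quot_scaleDr : right_distributive quot_scale +%R.
Proof.
move=> c x y; rewrite -[x]quotReprK -[y]quotReprK.
by rewrite -raddfD !quotPiZ -raddfD scalerDr.
Qed.

Fact quot_scaleDl x : {morph quot_scale^~ x : a b / a + b}.
Proof. by move=> a b /=; rewrite -[x]quotReprK !quotPiZ -raddfD scalerDl. Qed.

HB.instance Definition _ := GRing.Zmodule_isLmodule.Build R Q
  quot_scaleA quot_scale1 quot_scaleDr quot_scaleDl.

Fact quotPi_is_scalable : scalable quotPi.
Proof. by move=> c a; rewrite -quotPiZ. Qed.

HB.instance Definition _ :=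
  GRing.isScalable.Build R A Q *:%R quotPi quotPi_is_scalable.

Fact quot_scaleAl (c : R) (x y : Q) : c *: (x * y) = (c *: x) * y.
Proof.
rewrite -[x]quotReprK -[y]quotReprK.
by rewrite -rmorphM -!linearZ -rmorphM scalerAl.
Qed.

HB.instance Definition _ := GRing.Lmodule_isLalgebra.Build R Q quot_scaleAl.

Fact quot_scaleAr (c : R) (x y : Q) : c *: (x * y) = x * (c *: y).
Proof.
rewrite -[x]quotReprK -[y]quotReprK.
by rewrite -rmorphM -!linearZ -rmorphM scalerAr.
Qed.

HB.instance Definition _ := GRing.Lalgebra_isAlgebra.Build R Q quot_scaleAr.

Section Lift.
Variables (B : algType R) (phi : {lrmorphism A -> B}).
Hypothesis phiS : forall a, S a -> phi a = 0.

Lemma lift_ideal a : ideal_of S a -> phi a = 0.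
Proof.
elim=> [|b /phiS //|b c _ b0 _ c0|x b y _ b0]; first exact: rmorph0.
  by rewrite raddfD/= b0 c0 addr0.
by rewrite !rmorphM /= b0 mulr0 mul0r.
Qed.

Lemma quot_lift_subproof :
  exists psi : {lrmorphism Q -> B}, forall a, psi (quotPi a) = phi a.
Proof.
pose f (x : Q) : B := phi (quotRepr x).
have fE a : f (quotPi a) = phi a.
  apply/esym/eqP; rewrite -subr_eq0 -raddfB /=.
  by apply/eqP/lift_ideal/ideal_ofB_repr.
have f_zmod : zmod_morphism f.
  by move=> x y; rewrite -[x]quotReprK -[y]quotReprK -raddfB !fE raddfB.
have f_mon : monoid_morphism f.
  split=> [|x y]; first by rewrite fE rmorph1.
  by rewrite -[x]quotReprK -[y]quotReprK -rmorphM !fE rmorphM.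
have f_scal : scalable f.
  by move=> c x; rewrite -[x]quotReprK -linearZ !fE linearZ.
pose mf := GRing.isZmodMorphism.Build Q B f f_zmod.
pose mm := GRing.isMonoidMorphism.Build Q B f f_mon.
pose ms := GRing.isScalable.Build R Q B *:%R f f_scal.
pose psi : {lrmorphism Q -> B} :=
  HB.pack f mf mm ms.
by exists psi.
Qed.

End Lift.
End Presented.

Section FreeAlgExt.
Variables (R : comNzRingType) (I : choiceType) (B : algType R).

Lemma freeAlg_ext (phi psi : {lrmorphism freeAlg R I -> B}) :
  (forall x, phi (freeGen R x) = psi (freeGen R x)) -> phi =1 psi.
Proof.
move=> eqg a; pose aa : {malg R[{fmonom I}]} := a.
have -> : a = \sum_(k <- msupp aa) aa@_k *: (<< k >> : freeAlg R I).
  rewrite [LHS](monalgE aa); apply: eq_bigr => k _.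
  by apply/malgP => l; rewrite mcoeffZ !mcoeffU mulr_natr.
rewrite (raddf_sum phi) (raddf_sum psi) /=; apply: eq_bigr => k _.
rewrite !linearZ /=; congr (_ *: _).
case: k => s; elim: s => [|x s IHs].
  have -> : << FMonom [::] >> = 1 :> freeAlg R I.
    by congr (<< _ >>); rewrite -[RHS]/(fmone I) fmoneE.
  by rewrite !rmorph1.
have -> : << FMonom (x :: s) >> = freeGen R x * << FMonom s >> :> freeAlg R I.
  rewrite -[RHS]/(fgmul _ _) fgmulUU mulr1; congr (<< _ >>).
  by rewrite -[RHS]/(fmmul _ _) fmmulE fmuE.
by rewrite !rmorphM /= eqg IHs.
Qed.

End FreeAlgExt.

(* The generators: e_i is indexed by [inl i] and f_j by [inr j]. *)
Definition geomIdx (p q : nat) : choiceType := ('I_p + 'I_q)%type.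

Section Clifford.
Variables (R : comNzRingType) (p q : nat).
Local Notation X x := (@freeGen R (geomIdx p q) x).

Inductive geomRel : freeAlg R (geomIdx p q) -> Prop :=
| geomRel_anticomm (x y : geomIdx p q) : x <> y ->
    geomRel (X x * X y + X y * X x)
| geomRel_e (i : 'I_p) : geomRel (X (inl i) ^+ 2 - 1)
| geomRel_f (j : 'I_q) : geomRel (X (inr j) ^+ 2 + 1).

Record geom_relations (B : algType R) (e : 'I_p -> B) (f : 'I_q -> B) : Prop := {
  geom_ee : forall i i' : 'I_p, i <> i' -> e i * e i' = - (e i' * e i);
  geom_ff : forall j j' : 'I_q, j <> j' -> f j * f j' = - (f j' * f j);
  geom_ef : forall (i : 'I_p) (j : 'I_q), e i * f j = - (f j * e i);
  geom_e2 : forall i : 'I_p, e i ^+ 2 = 1;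
  geom_f2 : forall j : 'I_q, f j ^+ 2 = -1
}.

Definition geom_pair (B : Type) (e : 'I_p -> B) (f : 'I_q -> B)
  (x : geomIdx p q) : B := match x with inl i => e i | inr j => f j end.

Lemma geom_relations_lift (B : algType R) (e : 'I_p -> B) (f : 'I_q -> B) :
  geom_relations e f ->
  forall a, geomRel a -> freeLift (geom_pair e f) a = 0.
Proof.
case=> ee ff ef e2 f2 a [x y xy|i|j].
- pose phi : {lrmorphism _ -> _} := freeLift (geom_pair e f).
  have phiM u v : phi (X u * X v) = geom_pair e f u * geom_pair e f v.
    by rewrite rmorphM /= !freeLift_gen.
  apply: etrans (raddfD phi _ _) _; rewrite [LHS](congr2 +%R (phiM x y) (phiM y x)).
  case: x y xy => [i|j] [i'|j'] xy /=.
  + by rewrite ee ?addNr // => ii; apply: xy; rewrite ii.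
  + by rewrite ef addNr.
  + by rewrite ef addrN.
  + by rewrite ff ?addNr // => jj; apply: xy; rewrite jj.
- by rewrite rmorphB rmorphXn rmorph1 /= freeLift_gen /= e2 subrr.
- by rewrite rmorphD rmorphXn rmorph1 /= freeLift_gen /= f2 addNr.
Qed.

End Clifford.

Lemma anticomm_matrices (R : comNzRingType) (s : nat -> R) (n : nat) :
  exists (m : nat) (E : nat -> 'M[R]_m.+1),
    (forall i, (i < n)%N -> E i * E i = (s i)%:M) /\
    (forall i j, (i < n)%N -> (j < n)%N -> i <> j -> E i * E j = - (E j * E i)).
Proof.
elim: n => [|n [m [E [E2 EE]]]]; first by exists 0, (fun=> 0).
exists (m + m.+1)%N.
pose E' i : 'M[R]_(m.+1 + m.+1) :=
  if (i < n)%N then block_mx (E i) 0 0 (- E i) else block_mx 0 (s n)%:M 1%:M 0.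
exists E'.
have lt_or i : (i < n.+1)%N -> (i < n)%N \/ i = n.
  by rewrite ltnS leq_eqVlt => /orP[/eqP|]; [right|left].
have mixed i : (i < n)%N -> E' i *m E' n = - (E' n *m E' i).
  move=> ltin; rewrite /E' ltin ltnn !mulmx_block.
  rewrite !mulmx0 !mul0mx !mulmx1 !mul1mx !addr0 !add0r (@opp_block_mx _ m.+1 m.+1 m.+1 m.+1) !oppr0.
  by rewrite mulmxN opprK scalar_mxC.
split=> [i /lt_or[ltin|->]|i j /lt_or[ltin|->] /lt_or[ltjn|->] ij].
- rewrite -[LHS]/(E' i *m E' i) /E' ltin mulmx_block.
  rewrite !mulmx0 !mul0mx !addr0 !add0r mulNmx mulmxN opprK.
  have := E2 i ltin; rewrite -[E i * E i]/(E i *m E i) => ->.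
  by rewrite -scalar_mx_block.
- rewrite -[LHS]/(E' n *m E' n) /E' ltnn mulmx_block.
  rewrite !mulmx0 !mul0mx !mulmx1 !mul1mx !addr0 !add0r.
  by rewrite -scalar_mx_block.
- have := EE i j ltin ltjn ij.
  rewrite -[E i * E j]/(E i *m E j) -[E j * E i]/(E j *m E i) => Eij.
  rewrite -[LHS]/(E' i *m E' j) -[E' j * E' i]/(E' j *m E' i) /E' ltin ltjn.
  rewrite !mulmx_block !mulmx0 !mul0mx !addr0 !add0r !mulNmx !mulmxN !opprK.
  by rewrite (@opp_block_mx _ m.+1 m.+1 m.+1 m.+1) !oppr0 Eij.
- exact: mixed.
- by apply/oppr_inj; rewrite opprK; apply/esym/mixed.
- by [].
Qed.

Lemma geom_proper (R : comNzRingType) (p q : nat) :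
  ~ ideal_of (@geomRel R p q) 1.
Proof.
pose s k : R := if (k < p)%N then 1 else -1.
have [m [E [E2 EE]]] := anticomm_matrices s (p + q).
pose e (i : 'I_p) := E i; pose f (j : 'I_q) := E (p + j)%N.
have ltp (i : 'I_p) : (i < p + q)%N by rewrite ltn_addr.
have ltq (j : 'I_q) : (p + j < p + q)%N by rewrite ltn_add2l.
have rel : geom_relations e f.
  split=> [i i' ii|j j' jj|i j|i|j]; rewrite /e /f.
  - by apply: EE => // /val_inj.
  - by apply: EE => // /addnI/val_inj.
  - by apply: EE => // ij; have := ltn_ord i; rewrite ij ltnNge leq_addr.
  - by rewrite expr2 E2 // /s ltn_ord.
  - by rewrite expr2 E2 // /s ltnNge leq_addr /= raddfN.
move/(lift_ideal (geom_relations_lift rel)); rewrite rmorph1.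
by apply/eqP; rewrite oner_eq0.
Qed.

(* Quotient of the free algebra by the two-sided ideal of the relations; see
   [geomAlg_relations] and [geomAlg_universal] for its universal property. *)
Definition geomAlg (R : comNzRingType) (p q : nat) : algType R :=
  quotAlg (@geom_proper R p q).

Notation "''G[' R ]_ ( p , q )" := (geomAlg R p q)
  (at level 0, p at level 50, q at level 50, format "''G[' R ]_ ( p ,  q )").

Section GeomAlgTheory.
Variables (R : comNzRingType) (p q : nat).

Definition geomGen (x : geomIdx p q) : 'G[R]_(p, q) :=
  quotPi (@geom_proper R p q) (freeGen R x).

Definition ge (i : 'I_p) : 'G[R]_(p, q) := geomGen (inl i).
Definition gf (j : 'I_q) : 'G[R]_(p, q) := geomGen (inr j).

Definition pseudoscalar : 'G[R]_(p, q) :=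
  (\prod_(i < p) ge i) * (\prod_(j < q) gf j).

Lemma geomAlg_relations : geom_relations ge gf.
Proof.
have rel0 a : geomRel a -> quotPi (@geom_proper R p q) a = 0.
  move=> Sa; rewrite -[RHS](raddf0 (quotPi (@geom_proper R p q))).
  by apply/quotPi_eq; rewrite subr0; exact: ideal_of_gen.
have anti x y : x <> y -> geomGen x * geomGen y = - (geomGen y * geomGen x).
  move=> /(geomRel_anticomm R) xy; apply/eqP; rewrite -addr_eq0; apply/eqP.
  pose pi : {rmorphism _ -> _} := quotPi (@geom_proper R p q).
  have piM u v : geomGen u * geomGen v = pi (freeGen R u * freeGen R v).
    by rewrite rmorphM.
  rewrite !piM; apply: etrans (esym (raddfD pi _ _)) _; exact: rel0.
split=> [i i' ii|j j' jj|i j|i|j].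
- by apply: anti => -[].
- by apply: anti => -[].
- exact: anti.
- apply/eqP; rewrite -subr_eq0; apply/eqP.
  by have := rel0 _ (geomRel_e R q i); rewrite raddfB /= rmorphXn rmorph1.
- apply/eqP; rewrite -addr_eq0; apply/eqP.
  by have := rel0 _ (geomRel_f R p j); rewrite raddfD /= rmorphXn rmorph1.
Qed.

Lemma geomAlg_universal (B : algType R) (e : 'I_p -> B) (f : 'I_q -> B) :
  geom_relations e f ->
  exists psi : {lrmorphism 'G[R]_(p, q) -> B},
    [/\ forall i, psi (ge i) = e i, forall j, psi (gf j) = f j &
     forall psi' : {lrmorphism 'G[R]_(p, q) -> B},
       (forall i, psi' (ge i) = e i) -> (forall j, psi' (gf j) = f j) ->
       psi' =1 psi].
Proof.
move=> rel.
have [psi psiE] := quot_lift_subproof (@geom_proper R p q)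
  (geom_relations_lift rel).
exists psi; split=> [i|j|psi' psi'e psi'f x].
- by rewrite /ge /geomGen psiE /= freeLift_gen.
- by rewrite /gf /geomGen psiE /= freeLift_gen.
rewrite -[x](@quotReprK _ _ _ (@geom_proper R p q)).
have := @freeAlg_ext R (geomIdx p q) B
  (psi' \o quotPi (@geom_proper R p q) : {lrmorphism _ -> _})
  (psi \o quotPi (@geom_proper R p q) : {lrmorphism _ -> _}).
apply=> -[i|j] /=; rewrite psiE /= freeLift_gen /=.
- exact: psi'e.
- exact: psi'f.
Qed.

End GeomAlgTheory.

(* The library only makes [Rcomplex R] = [R[i]] a left [R]-algebra. *)
Fact Rcomplex_scalerAr (R : fieldType) (c : R) (x y : Rcomplex R) :
  c *: (x * y) = x * (c *: y).
Proof. by rewrite mulrC scalerAl mulrC. Qed.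

HB.instance Definition _ (R : fieldType) :=
  GRing.Lalgebra_isAlgebra.Build R (Rcomplex R) (@Rcomplex_scalerAr R).

(* [Quat a b c d] stands for a + b i + c j + d k. *)
Record quat (R : Type) : Type := Quat { qre : R; qi : R; qj : R; qk : R }.

Definition quat_tuple (R : Type) (x : quat R) : R * R * R * R :=
  let: Quat a b c d := x in (a, b, c, d).
Definition tuple_quat (R : Type) (t : R * R * R * R) : quat R :=
  let: (a, b, c, d) := t in Quat a b c d.
Lemma quat_tupleK (R : Type) : cancel (@quat_tuple R) (@tuple_quat R).
Proof. by case. Qed.

HB.instance Definition _ (R : choiceType) :=
  Choice.copy (quat R) (can_type (@quat_tupleK R)).

Section Quaternions.
Variable R : comNzRingType.

Definition quat0 : quat R := Quat 0 0 0 0.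
Definition quat1 : quat R := Quat 1 0 0 0.
Definition addq (x y : quat R) : quat R :=
  let: Quat a b c d := x in let: Quat a' b' c' d' := y in
  Quat (a + a') (b + b') (c + c') (d + d').
Definition oppq (x : quat R) : quat R :=
  let: Quat a b c d := x in Quat (- a) (- b) (- c) (- d).
(* i^2 = j^2 = k^2 = i j k = -1 *)
Definition mulq (x y : quat R) : quat R :=
  let: Quat a b c d := x in let: Quat a' b' c' d' := y in
  Quat (a * a' - b * b' - c * c' - d * d')
       (a * b' + b * a' + c * d' - d * c')
       (a * c' - b * d' + c * a' + d * b')
       (a * d' + b * c' - c * b' + d * a').
Definition scaleq (t : R) (x : quat R) : quat R :=
  let: Quat a b c d := x in Quat (t * a) (t * b) (t * c) (t * d).

Fact addqA : associative addq.
Proof. by case=> a b c d [? ? ? ?] [? ? ? ?] /=; congr Quat; ring. Qed.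
Fact addqC : commutative addq.
Proof. by case=> a b c d [? ? ? ?] /=; congr Quat; ring. Qed.
Fact add0q : left_id quat0 addq.
Proof. by case=> a b c d /=; congr Quat; ring. Qed.
Fact addNq : left_inverse quat0 oppq addq.
Proof. by case=> a b c d; rewrite /quat0 /=; congr Quat; ring. Qed.

HB.instance Definition _ :=
  GRing.isZmodule.Build (quat R) addqA addqC add0q addNq.

Fact mulqA : associative mulq.
Proof. by case=> a b c d [? ? ? ?] [? ? ? ?] /=; congr Quat; ring. Qed.
Fact mul1q : left_id quat1 mulq.
Proof. by case=> a b c d /=; congr Quat; ring. Qed.
Fact mulq1 : right_id quat1 mulq.
Proof. by case=> a b c d /=; congr Quat; ring. Qed.
Fact mulqDl : left_distributive mulq addq.
Proof. by case=> a b c d [? ? ? ?] [? ? ? ?] /=; congr Quat; ring. Qed.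
Fact mulqDr : right_distributive mulq addq.
Proof. by case=> a b c d [? ? ? ?] [? ? ? ?] /=; congr Quat; ring. Qed.
Fact quat1_neq0 : quat1 != quat0.
Proof. by apply/eqP => -[] /eqP; rewrite oner_eq0. Qed.

HB.instance Definition _ := GRing.Zmodule_isNzRing.Build (quat R)
  mulqA mul1q mulq1 mulqDl mulqDr quat1_neq0.

Fact scaleqA s t x : scaleq s (scaleq t x) = scaleq (s * t) x.
Proof. by case: x => a b c d /=; congr Quat; ring. Qed.
Fact scale1q : left_id 1 scaleq.
Proof. by case=> a b c d /=; congr Quat; ring. Qed.
Fact scaleqDr : right_distributive scaleq +%R.
Proof. by move=> t [a b c d] [? ? ? ?]; congr Quat; ring. Qed.
Fact scaleqDl x : {morph scaleq^~ x : s t / s + t}.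
Proof. by case: x => a b c d s t; congr Quat; ring. Qed.

HB.instance Definition _ := GRing.Zmodule_isLmodule.Build R (quat R)
  scaleqA scale1q scaleqDr scaleqDl.

Fact scaleqAl (t : R) (x y : quat R) : t *: (x * y) = (t *: x) * y.
Proof. by case: x y => a b c d [? ? ? ?]; congr Quat; ring. Qed.
HB.instance Definition _ := GRing.Lmodule_isLalgebra.Build R (quat R) scaleqAl.

Fact scaleqAr (t : R) (x y : quat R) : t *: (x * y) = x * (t *: y).
Proof. by case: x y => a b c d [? ? ? ?]; congr Quat; ring. Qed.
HB.instance Definition _ := GRing.Lalgebra_isAlgebra.Build R (quat R) scaleqAr.

End Quaternions.

(* [matAlg m A] is the [R]-algebra M_m(A), for m > 0: the size [m.-1.+1]
   reduces to [m] when m is a positive numeral.  An alias is needed because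
   the library's scaling on ['M[A]_m] is by scalars in [A], not in [R]. *)
Definition matAlg (R : comNzRingType) (m : nat) (A : algType R) : Type :=
  'M[A]_m.-1.+1.

Section MatAlg.
Variables (R : comNzRingType) (A : algType R) (m : nat).
Local Notation M := (matAlg m A).

HB.instance Definition _ := GRing.NzRing.copy M 'M[A]_m.-1.+1.

Definition mat_scale (t : R) (X : M) : M := map_mx (fun x : A => t *: x) X.

Fact mat_scaleA s t X : mat_scale s (mat_scale t X) = mat_scale (s * t) X.
Proof. by apply/matrixP => i j; rewrite !mxE scalerA. Qed.
Fact mat_scale1 : left_id 1 mat_scale.
Proof. by move=> X; apply/matrixP => i j; rewrite !mxE scale1r. Qed.
Fact mat_scaleDr : right_distributive mat_scale +%R.
Proof. by move=> t X Y; apply/matrixP => i j; rewrite !mxE scalerDr. Qed.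
Fact mat_scaleDl X : {morph mat_scale^~ X : s t / s + t}.
Proof. by move=> s t /=; apply/matrixP => i j; rewrite !mxE scalerDl. Qed.

HB.instance Definition _ := GRing.Zmodule_isLmodule.Build R M
  mat_scaleA mat_scale1 mat_scaleDr mat_scaleDl.

Fact mat_scaleAl (t : R) (X Y : M) : t *: (X * Y) = (t *: X) * Y.
Proof.
apply/matrixP => i j; rewrite !mxE scaler_sumr.
by apply: eq_bigr => k _; rewrite mxE scalerAl.
Qed.
HB.instance Definition _ := GRing.Lmodule_isLalgebra.Build R M mat_scaleAl.

Fact mat_scaleAr (t : R) (X Y : M) : t *: (X * Y) = X * (t *: Y).
Proof.
apply/matrixP => i j; rewrite !mxE scaler_sumr.
by apply: eq_bigr => k _; rewrite mxE scalerAr.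
Qed.
HB.instance Definition _ := GRing.Lalgebra_isAlgebra.Build R M mat_scaleAr.

End MatAlg.

Definition dblAlg (R : comNzRingType) (A : algType R) : algType R :=
  (A * A)%type.

(* Main.v *)
From HB Require Import structures.
Require Import Defs.
From mathcomp Require Import all_boot all_order all_algebra.
From mathcomp Require Import reals complex.
From mathcomp Require Import finmap zify ring.
From mathcomp.multinomials Require Import monalg.

Set Implicit Arguments.
Unset Strict Implicit.
Unset Printing Implicit Defensive.

Import Order.TTheory GRing.Theory Num.Theory.

Local Open Scope ring_scope.

(* By the anticommutation relations G_{p,q} is spanned by the 2^(p+q) ordered
   products of distinct generators, so an algebra B of dimension at least
   2^(p+q) that is generated by elements satisfying the relations of G_{p,q}
   is isomorphic to it.  Such generators are found by recursion.  If U, V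
   anticommute in M_2(R) and U^2 = 1, multiplying the generators x of B by U V
   and adjoining U and V gives generators of M_2(B); for V^2 = -1 the squares
   of the x are preserved, so (p,q) becomes (p+1,q+1), and for V^2 = 1 they are
   negated, so (p,q) becomes (q+2,p).  Multiplying four generators of square 1
   by their product turns (4,q) into (0,q+4).  Starting from R, R x R, C, H and
   H x H, of types (0,0), (1,0), (0,1), (0,2) and (0,3), all cases with
   p + q <= 7 are reached. *)

(** * Anticommuting families and the square of their product *)

Definition anticommute (B : pzRingType) (x y : B) : bool := x * y == - (y * x).

Definition clifford_system (B : pzRingType) (le lf : seq B) : bool :=
  [&& pairwise (@anticommute B) (le ++ lf), all (fun x => x ^+ 2 == 1) le
    & all (fun x => x ^+ 2 == -1) lf].

Lemma clifford_systemP (B : pzRingType) (le lf : seq B) :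
  reflect
    ([/\ pairwise (@anticommute B) le, pairwise (@anticommute B) lf
       & {in le & lf, forall x y, anticommute x y}] /\
     {in le, forall x, x ^+ 2 = 1} /\ {in lf, forall x, x ^+ 2 = -1})
    (clifford_system le lf).
Proof.
rewrite /clifford_system pairwise_cat; apply: (iffP and3P).
  case=> /and3P[/allrelP lef ple plf] /allP le1 /allP lf1.
  by split=> //; split=> x => [/le1/eqP|/lf1/eqP].
case=> -[ple plf lef] [le1 lf1]; split.
- by rewrite ple plf !andbT; apply/allrelP.
- by apply/allP => x /le1 ->.
- by apply/allP => x /lf1 ->.
Qed.

Lemma anticommuteC (B : pzRingType) : symmetric (@anticommute B).
Proof. by move=> x y; rewrite /anticommute -eqr_oppLR eq_sym. Qed.

(** Each factor that [x] crosses costs one sign. *)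
Lemma anticommute_prod (B : pzRingType) (x : B) (l : seq B) :
  all (anticommute x) l ->
  (\prod_(y <- l) y) * x = (-1) ^+ size l * (x * \prod_(y <- l) y).
Proof.
elim: l => [|y l IHl] /=; first by rewrite big_nil !mul1r mulr1.
case/andP=> /eqP xy /IHl xl; rewrite big_cons -mulrA xl exprS mulN1r mulNr.
rewrite (mulrA y) (commr_sign y) -mulrA -mulrN.
by congr (_ * _); rewrite !mulrA xy mulNr opprK.
Qed.

(** In the square of the product of [x :: l], moving the second [x] across the product of [l] gives
    the sign [(-1) ^+ size l]. For [n] elements these sizes add up to ['C(n, 2)], and each element
    of [lf] contributes a further [-1] from its own square. *)
Lemma clifford_prod_sqr (B : pzRingType) (le lf : seq B) :
  clifford_system le lf ->
  (\prod_(x <- le ++ lf) x) ^+ 2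
    = (-1) ^+ ('C(size le + size lf, 2) + size lf).
Proof.
have step (x : B) l : all (anticommute x) l ->
    (\prod_(y <- x :: l) y) ^+ 2
      = (-1) ^+ size l * x ^+ 2 * (\prod_(y <- l) y) ^+ 2.
  move=> /anticommute_prod xl; rewrite big_cons expr2 -mulrA (mulrA _ x) xl.
  by rewrite !expr2 !mulrA (commr_sign x).
case/clifford_systemP=> -[ple plf lef] [le1 lf1].
elim: le ple lef le1 => [|x le IHle] /=.
  move=> _ _ _; elim: lf plf lf1 => [|x lf IHlf] /=.
    by rewrite big_nil expr1n.
  case/andP=> xlf /IHlf{}IHlf lf1; rewrite step // lf1 ?mem_head //.
  rewrite IHlf => [|y ylf]; last by rewrite lf1 // mem_behead.
  by rewrite !add0n -exprSr -exprD binS bin1; congr (_ ^+ _); lia.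
case/andP=> xle /IHle{}IHle lef le1.
rewrite step ?all_cat ?xle /=; last first.
  by apply/allP => y; apply: lef; apply: mem_head.
rewrite le1 ?mem_head // mulr1 IHle => [|y z yle|y yle]; first last.
- by apply: le1; rewrite mem_behead.
- by apply: lef; rewrite mem_behead.
by rewrite -exprD addSn binS bin1 size_cat; congr (_ ^+ _); lia.
Qed.

(** * Generated subalgebras and generating Clifford systems *)

Section Generation.
Variables (R : comNzRingType) (B : algType R).

Inductive alg_gen (S : B -> Prop) : B -> Prop :=
| alg_gen_in x : S x -> alg_gen S x
| alg_gen_1 : alg_gen S 1
| alg_gen_add x y : alg_gen S x -> alg_gen S y -> alg_gen S (x + y)
| alg_gen_mul x y : alg_gen S x -> alg_gen S y -> alg_gen S (x * y)
| alg_gen_scale c x : alg_gen S x -> alg_gen S (c *: x).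

Lemma alg_gen_trans (S T : B -> Prop) :
  (forall x, S x -> alg_gen T x) -> forall x, alg_gen S x -> alg_gen T x.
Proof.
move=> ST x; elim=> [y /ST //||y z _ + _|y z _ + _|c y _].
- exact: alg_gen_1.
- exact: alg_gen_add.
- exact: alg_gen_mul.
- exact: alg_gen_scale.
Qed.

Lemma alg_gen_opp S x : alg_gen S x -> alg_gen S (- x).
Proof. by move=> Sx; rewrite -scaleN1r; exact: alg_gen_scale. Qed.

End Generation.

Lemma alg_gen_img (R : comNzRingType) (B C : algType R)
    (phi : {lrmorphism B -> C}) (S : B -> Prop) (T : C -> Prop) :
  (forall x, S x -> alg_gen T (phi x)) ->
  forall x, alg_gen S x -> alg_gen T (phi x).
Proof.
move=> ST x; elim=> [y /ST //||y z _ + _|y z _ + _|c y _].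
- rewrite rmorph1; exact: alg_gen_1.
- rewrite rmorphD; exact: alg_gen_add.
- rewrite rmorphM; exact: alg_gen_mul.
- rewrite linearZ; exact: alg_gen_scale.
Qed.

(** By the universal property this makes [B] a quotient of ['G[R]_(p, q)]; the dimension is
    controlled separately, by [dim_geq]. *)
Definition geom_type (R : comNzRingType) (p q : nat) (B : algType R) : Prop :=
  exists le lf : seq B,
    [/\ size le = p, size lf = q, clifford_system le lf
      & forall b, alg_gen (fun x => x \in le ++ lf) b].

(** * Linear span of the ordered monomials *)

Section Span.
Variables (R : comNzRingType) (B : algType R).

Fixpoint monomials (l : seq B) : seq B :=
  if l is x :: l' then monomials l' ++ map ( *%R x) (monomials l') else [:: 1].

Lemma size_monomials l : size (monomials l) = (2 ^ size l)%N.
Proof.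
by elim: l => //= x l IHl; rewrite size_cat size_map IHl addnn -mul2n expnS.
Qed.

(** Coefficients are indexed by [nat] instead of ['I_(size T)], so that concatenation only shifts
    indices and no casts between ordinals arise. *)
Definition lincomb (T : seq B) (b : B) : Prop :=
  exists c : nat -> R, b = \sum_(i < size T) c i *: T`_i.

Lemma lincomb_add T a b : lincomb T a -> lincomb T b -> lincomb T (a + b).
Proof.
case=> c -> [d ->]; exists (fun i => c i + d i).
by rewrite -big_split; apply: eq_bigr => i _; rewrite scalerDl.
Qed.

Lemma lincomb_scale T k a : lincomb T a -> lincomb T (k *: a).
Proof.
case=> c ->; exists (fun i => k * c i).
by rewrite scaler_sumr; apply: eq_bigr => i _; rewrite scalerA.
Qed.

Lemma lincomb_cat T1 T2 b :
  lincomb (T1 ++ T2) b <->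
  exists b1 b2, [/\ lincomb T1 b1, lincomb T2 b2 & b = b1 + b2].
Proof.
split=> [[c ->]|[_] [_] [[c1 ->] [c2 ->] ->]].
  rewrite size_cat big_split_ord /=; do 2!eexists; split; last by [].
    by exists c; apply: eq_bigr => i _; rewrite nth_cat ltn_ord.
  exists (fun i => c (size T1 + i)%N); apply: eq_bigr => i _.
  by rewrite nth_cat ltnNge leq_addr /= addKn.
exists (fun i => if (i < size T1)%N then c1 i else c2 (i - size T1)%N).
rewrite size_cat big_split_ord /=; congr (_ + _); apply: eq_bigr => i _.
  by rewrite nth_cat ltn_ord.
by rewrite nth_cat ltnNge leq_addr /= addKn.
Qed.

Lemma lincomb_map x T b :
  lincomb (map ( *%R x) T) b <-> exists2 b', lincomb T b' & b = x * b'.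
Proof.
split=> [[c ->]|[_ [c ->] ->]].
  exists (\sum_(i < size T) c i *: T`_i); first by exists c.
  rewrite size_map mulr_sumr; apply: eq_bigr => i _.
  by rewrite (nth_map 0) // scalerAr.
exists c; rewrite size_map mulr_sumr; apply: eq_bigr => i _.
by rewrite (nth_map 0) // scalerAr.
Qed.

Lemma lincomb_monomials_cons x l b :
  lincomb (monomials (x :: l)) b <->
  exists a a', [/\ lincomb (monomials l) a, lincomb (monomials l) a'
                 & b = a + x * a'].
Proof.
rewrite /= lincomb_cat; split=> [[a [_ [la /lincomb_map[a' la' ->] ->]]]|].
  by exists a, a'.
case=> a [a' [la la' ->]]; exists a, (x * a'); split=> //.
by apply/lincomb_map; exists a'.
Qed.

Lemma lincomb_monomials1 l : lincomb (monomials l) 1.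
Proof.
elim: l => [|x l IHl].
  by exists (fun=> 1); rewrite big_ord1 scale1r.
(* The second witness is zero, written as a multiple of [1] so that [lincomb_scale] applies to
   it. *)
apply/lincomb_monomials_cons; exists 1, (0 *: 1); split=> //.
  exact: lincomb_scale.
by rewrite scale0r mulr0 addr0.
Qed.

(** Write [b = a + x * a'] with [x] the head of [l]. If [y = x] and [x ^+ 2 = c], then
    [y * b = c a' + x * a]. Otherwise [y] crosses [x] with a sign, [y * b = y * a - x * (y * a')],
    and induction handles [y * a] and [y * a']. *)
Lemma lincomb_monomials_mul l y b :
  pairwise (@anticommute B) l ->
  {in l, forall x, exists c : R, x ^+ 2 = c *: 1} ->
  y \in l -> lincomb (monomials l) b -> lincomb (monomials l) (y * b).
Proof.
elim: l b => // x l IHl b /= /andP[/allP xl pl] sql yl.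
case/lincomb_monomials_cons=> a [a' [la la' ->]].
apply/lincomb_monomials_cons; have [yx|] := eqVneq y x.
  have [c x2] := sql x (mem_head _ _); exists (c *: a'), a.
  split=> //; first exact: lincomb_scale.
  by rewrite yx mulrDr mulrA -expr2 x2 -scalerAl mul1r addrC.
move=> y'x; have {}yl : y \in l by move: yl; rewrite inE (negPf y'x).
have {}IHl d : lincomb (monomials l) d -> lincomb (monomials l) (y * d).
  by apply: IHl => // z zl; apply: sql; rewrite mem_behead.
exists (y * a), (-1 *: (y * a')); split; first exact: IHl.
  by apply: lincomb_scale; exact: IHl.
have := xl _ yl; rewrite anticommuteC => /eqP yx.
by rewrite mulrDr mulrA yx scaleN1r mulrN mulNr mulrA.
Qed.

End Span.

(** * The algebra ['G[R]_(p, q)]: spanning monomials and quotients *)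

Section Geom.
Variables (R : comNzRingType) (p q : nat).
Local Notation G := 'G[R]_(p, q).

(** The quotient map is onto and the free algebra is spanned by words, each built by prepending
    letters. Hence stability under left multiplication by generators suffices in place of arbitrary
    products. *)
Lemma geomAlg_ind (P : G -> Prop) :
  P 0 -> P 1 -> (forall x y, P x -> P y -> P (x + y)) ->
  (forall c x, P x -> P (c *: x)) ->
  (forall z x, P x -> P (geomGen R z * x)) -> forall x, P x.
Proof.
move=> P0 P1 PD PZ PM x; rewrite -[x](quotReprK (proper := @geom_proper R p q)).
set a := quotRepr x.
pose pi : {lrmorphism _ -> _} := quotPi (@geom_proper R p q).
rewrite -[quotPi _ a]/(pi a).
pose aa : {malg R[{fmonom (geomIdx p q)}]} := a.
have -> : a = \sum_(k <- msupp aa) aa@_k *: (<< k >> : freeAlg R (geomIdx p q)).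
  rewrite [LHS](monalgE aa); apply: eq_bigr => k _.
  by apply/malgP => l; rewrite mcoeffZ !mcoeffU mulr_natr.
rewrite raddf_sum; apply: (big_ind P) => // k _.
rewrite -[X in P X]/(pi _) linearZ; apply: PZ.
case: k => s; elim: s => [|z s IHs].
  have -> : << FMonom [::] >> = 1 :> freeAlg R (geomIdx p q).
    by congr (<< _ >>); rewrite -[RHS]/(fmone _) fmoneE.
  by rewrite rmorph1.
have -> : << FMonom (z :: s) >>
    = freeGen R z * << FMonom s >> :> freeAlg R (geomIdx p q).
  rewrite -[RHS]/(fgmul _ _) fgmulUU mulr1; congr (<< _ >>).
  by rewrite -[RHS]/(fmmul _ _) fmmulE fmuE.
by rewrite rmorphM; exact: PM.
Qed.

Definition ge_seq : seq G := [seq ge R q i | i <- enum 'I_p].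
Definition gf_seq : seq G := [seq gf R p j | j <- enum 'I_q].

Lemma size_ge_seq : size ge_seq = p.
Proof. by rewrite size_map; exact: size_enum_ord. Qed.

Lemma size_gf_seq : size gf_seq = q.
Proof. by rewrite size_map; exact: size_enum_ord. Qed.

Lemma geom_clifford_system : clifford_system ge_seq gf_seq.
Proof.
have [ee ff ef e2 f2] := geomAlg_relations R p q.
have pw (I : finType) (g : I -> G) :
    (forall i j, i <> j -> g i * g j = - (g j * g i)) ->
    pairwise (@anticommute G) [seq g i | i <- enum I].
  move=> gg; rewrite pairwise_map.
  (* [uniq] is the pairwise form of [!=], so the relation between distinct indices becomes pairwise
     anticommutation of the list. *)
  have: uniq (enum I) by apply: enum_uniq.
  rewrite uniq_pairwise; apply: sub_pairwise => i j /eqP/gg ij.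
  exact/eqP.
apply/clifford_systemP; split; [split|split].
- exact: pw.
- exact: pw.
- by move=> _ _ /mapP[i _ ->] /mapP[j _ ->]; apply/eqP/ef.
- by move=> _ /mapP[i _ ->].
- by move=> _ /mapP[i _ ->].
Qed.

Lemma pseudoscalar_sqr :
  pseudoscalar R p q ^+ 2 = (-1) ^+ ('C(p + q, 2) + q).
Proof.
have /clifford_prod_sqr := geom_clifford_system.
rewrite size_ge_seq size_gf_seq big_cat /= !big_map /pseudoscalar.
by rewrite [index_enum 'I_p]unlock [index_enum 'I_q]unlock.
Qed.

(** The span of the monomials contains [1] and is stable under left multiplication by generators, so
    [geomAlg_ind] applies. This bounds the dimension by [2 ^ (p + q)] from above. *)
Lemma geom_span (x : G) : lincomb (monomials (ge_seq ++ gf_seq)) x.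
Proof.
have one := lincomb_monomials1 (ge_seq ++ gf_seq).
elim/geomAlg_ind: x => //.
- by rewrite -(scale0r 1); exact: lincomb_scale.
- by move=> x y; exact: lincomb_add.
- by move=> c x; exact: lincomb_scale.
move=> z x; apply: lincomb_monomials_mul.
- by case/and3P: geom_clifford_system.
- case/clifford_systemP: geom_clifford_system => _ [e2 f2] y.
  rewrite mem_cat => /orP[/e2|/f2] ->; first by exists 1; rewrite scale1r.
  by exists (-1); rewrite scaleN1r.
- rewrite mem_cat; apply/orP; case: z => [i|j]; [left|right].
    by apply: map_f; rewrite mem_enum.
  by apply: map_f; rewrite mem_enum.
Qed.

(** The universal property maps the generators to those of [B]; the range is then a subalgebra
    containing a generating set. *)
Lemma geom_type_morphism (B : algType R) : geom_type p q B ->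
  exists phi : {lrmorphism G -> B}, forall b, exists x, phi x = b.
Proof.
case=> le [lf [sle slf cs gen]].
case/clifford_systemP: cs => -[/(pairwiseP 0) ple /(pairwiseP 0) plf lef].
case=> le1 lf1.
(* [pairwiseP] speaks only of indices [i < j]; symmetry of [anticommute] covers the other order. *)
have nthS n (l : seq B) : size l = n ->
    {in gtn n &, {homo nth 0 l : i j / (i < j)%N >-> anticommute i j}} ->
    forall i j : 'I_n, i <> j -> l`_i * l`_j = - (l`_j * l`_i).
  move=> sl homl i j /eqP; rewrite -val_eqE neq_ltn => ij.
  apply/eqP; rewrite -/(anticommute _ _).
  by case/orP: ij => /homl; [|rewrite anticommuteC]; apply; rewrite inE ltn_ord.
have nle (i : 'I_p) : le`_i \in le by rewrite mem_nth ?sle.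
have nlf (j : 'I_q) : lf`_j \in lf by rewrite mem_nth ?slf.
have rel : geom_relations (fun i : 'I_p => le`_i) (fun j : 'I_q => lf`_j).
  split=> [||i j|i|j].
  - by apply: nthS => //; rewrite -sle.
  - by apply: nthS => //; rewrite -slf.
  - by apply/eqP/lef.
  - exact: le1.
  - exact: lf1.
have [phi [phie phif _]] := geomAlg_universal rel.
exists phi => b.
elim: {b}(gen b)
    => [x||x y _ [u <-] _ [v <-]|x y _ [u <-] _ [v <-]|c x _ [u <-]].
- rewrite mem_cat => /orP[] /(nthP 0)[k].
    by rewrite sle => ltkp <-; exists (ge R q (Ordinal ltkp)).
  by rewrite slf => ltkq <-; exists (gf R p (Ordinal ltkq)).
- by exists 1; rewrite rmorph1.
- by exists (u + v); rewrite rmorphD.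
- by exists (u * v); rewrite rmorphM.
- by exists (c *: u); rewrite linearZ.
Qed.

End Geom.

(** * Isomorphism from a lower bound on the dimension *)

(** The bound is witnessed by a linear surjection onto a [vectType], so [B] itself does not have to
    carry that structure. *)
Definition dim_geq (R : fieldType) (B : lmodType R) (n : nat) : Prop :=
  exists2 V : vectType R, dim V = n
    & exists f : {linear B -> V}, forall v, exists b, f b = v.

(** The images in [V] of the [2 ^ (p + q)] monomials span [V] and are as many as [dim V], hence form
    a basis. An element of the kernel of [phi], written in the monomials, therefore has only zero
    coefficients. *)
Lemma geomAlg_isom (R : fieldType) (p q : nat) (B : algType R) :
  geom_type p q B -> dim_geq B (2 ^ (p + q)) -> 'G[R]_(p, q) ≅ B.
Proof.
case/geom_type_morphism=> phi phi_surj [V dimV [f f_surj]]; exists phi.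
have inj : injective phi.
  apply: raddf_inj => x phix0.
  set T := monomials (ge_seq R p q ++ gf_seq R p q).
  have sT : size T = dim V.
    by rewrite size_monomials size_cat size_ge_seq size_gf_seq dimV.
  pose g := f \o phi : {linear _ -> _}; pose X := map g T.
  have gsum (c : nat -> R) :
      g (\sum_(i < size T) c i *: T`_i) = \sum_(i < size X) c i *: X`_i.
    rewrite size_map linear_sum; apply: eq_bigr => i _.
    by rewrite linearZ (nth_map 0).
  have Xbasis : basis_of {:V} X.
    rewrite basisEdim size_map sT dimvf leqnn andbT; apply/subvP => v _.
    have [b <-] := f_surj v; have [y <-] := phi_surj b.
    have [c ->] := geom_span y; rewrite -[f _]/(g _) gsum.
    apply: rpred_sum => i _; apply: rpredZ; apply: memv_span.
    exact: mem_nth.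
  have [c xE] := geom_span x.
  have gx0 : g x = 0 by rewrite /= phix0 raddf0.
  move: gx0; rewrite xE gsum => c0.
  have {}c0 : forall i : 'I_(size X), c i = 0.
    have /(@freeP _ _ _ (in_tuple X)) := basis_free Xbasis.
    by move=> /(_ (fun i => c i) c0).
  rewrite big1 // => i _; rewrite -(size_map g T) in i *.
  by have := c0 i; rewrite /= => ->; rewrite scale0r.
(* Choice of preimages turns surjectivity into the inverse function that [bijective] asks for. *)
have surj b : {x | phi x == b}.
  by apply: sigW; have [x <-] := phi_surj b; exists x.
exists (fun b => sval (surj b)) => [x|b]; last by case: (surj b) => x /= /eqP.
by case: (surj _) => y /= /eqP/inj.
Qed.

(** * Doubling: adjoining two anticommuting generators *)

Section Doubling.
Variables (R : comNzRingType) (B C : algType R) (phi : {lrmorphism B -> C}).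
Variables (U V : C).
Hypotheses (UV : anticommute U V) (U2 : U ^+ 2 = 1).
Hypotheses (phiU : forall x, GRing.comm U (phi x)).
Hypotheses (phiV : forall x, GRing.comm V (phi x)).
Hypothesis phi_span : forall c, exists x1 x2 x3 x4,
  c = phi x1 + phi x2 * U + phi x3 * V + phi x4 * (U * V).

(** [U * V] commutes with the range of [phi] and anticommutes with [U] and [V], so twisted elements
    anticommute with [U] and [V]. As [(U * V) ^+ 2 = - V ^+ 2], twisting multiplies squares by
    [- V ^+ 2]. *)
Let twist x := U * V * phi x.

Let phiUV x : GRing.comm (U * V) (phi x).
Proof. by apply/commr_sym/commrM; apply/commr_sym. Qed.

Let twistM x y : twist x * twist y = - (V ^+ 2 * phi (x * y)).
Proof.
rewrite /twist -mulrA (mulrA (phi x)) -phiUV -!mulrA -rmorphM !mulrA.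
have /eqP VU := UV; rewrite -(mulrA U) -[V * U]opprK -VU mulrN mulrA -expr2 U2.
by rewrite mul1r !mulNr -expr2.
Qed.

Let twist_anticommute x y :
  anticommute x y -> anticommute (twist x) (twist y).
Proof. by move=> /eqP xy; rewrite /anticommute !twistM xy rmorphN mulrN. Qed.

Let U_twist x : anticommute U (twist x).
Proof.
have /eqP VU := UV; rewrite /anticommute /twist -[_ * phi x * U]mulrA -phiU.
by rewrite !mulrA -[U * V * U]mulrA -[V * U]opprK -VU mulrN mulNr opprK mulrA.
Qed.

Let V_twist x : anticommute V (twist x).
Proof.
have /eqP VU := UV; rewrite /anticommute /twist -[_ * phi x * V]mulrA -phiV.
by rewrite !mulrA -[V * U]opprK -VU !mulNr.
Qed.

(** Since [twist 1 = U * V], [twistM] gives [U * V * twist y = - (v *: phi y)]; as [v ^+ 2 = 1],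
    scaling by [- v] recovers [phi y]. Then [phi_span] yields all of [C]. *)
Let twist_gen (S : B -> Prop) (T : C -> Prop) (v : R) :
  V ^+ 2 = v *: 1 -> v ^+ 2 = 1 -> T U -> T V ->
  (forall x, S x -> T (twist x)) -> (forall x, alg_gen S x) ->
  forall c, alg_gen T c.
Proof.
move=> V2 v2 TU TV ST genS c; have [x1 [x2 [x3 [x4 ->]]]] := phi_span c.
have gU : alg_gen T U by exact: alg_gen_in.
have gV : alg_gen T V by exact: alg_gen_in.
have gUV : alg_gen T (U * V) by exact: alg_gen_mul.
have gphi x : alg_gen T (phi x).
  apply: alg_gen_img (genS x) => y Sy.
  suff -> : phi y = - v *: (U * V * twist y).
    by apply/alg_gen_scale/alg_gen_mul => //; apply/alg_gen_in/ST.
  rewrite -[U * V]mulr1 -(rmorph1 phi) -/(twist 1) twistM mul1r V2.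
  by rewrite -scalerAl mul1r scalerN scaleNr opprK scalerA -expr2 v2 scale1r.
by do ?[apply: alg_gen_add | apply: alg_gen_mul].
Qed.

Let twist_pairwise l :
  pairwise (@anticommute B) l -> pairwise (@anticommute C) (map twist l).
Proof.
by rewrite pairwise_map; apply: sub_pairwise => x y; exact: twist_anticommute.
Qed.

Let U_twists l : all (anticommute U) (map twist l).
Proof. by rewrite all_map; apply/allP => x _; exact: U_twist. Qed.

Let V_twists l : all (anticommute V) (map twist l).
Proof. by rewrite all_map; apply/allP => x _; exact: V_twist. Qed.

Let twist_sqr (v : R) x b : V ^+ 2 = v *: 1 -> x ^+ 2 = b *: 1 ->
  twist x ^+ 2 = (- (v * b)) *: 1.
Proof.
move=> V2 x2; rewrite expr2 twistM -expr2 x2 V2 linearZ rmorph1 /=.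
by rewrite -scalerAl mul1r scalerA scaleNr.
Qed.

(** Here [- V ^+ 2 = 1], so twists keep their squares; [U] joins the elements of square [1] and [V]
    those of square [-1]. *)
Lemma geom_type_double p q :
  V ^+ 2 = -1 -> geom_type p q B -> geom_type p.+1 q.+1 C.
Proof.
move=> V2 [le [lf [<- <- /clifford_systemP[[ple plf lef] [le1 lf1]] gen]]].
have V2' : V ^+ 2 = (-1) *: 1 by rewrite V2 scaleN1r.
exists (U :: map twist le), (V :: map twist lf).
split; rewrite /= ?size_map //; last first.
  move=> c; apply: (twist_gen V2') gen c => [|||x].
  - by rewrite expr2 mulrNN mulr1.
  - exact: mem_head.
  - by rewrite in_cons mem_cat in_cons eqxx !orbT.
  by rewrite mem_cat => /orP[] xl;
    rewrite in_cons mem_cat in_cons (map_f _ xl) ?orbT.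
apply/clifford_systemP; split; [split|split].
- by rewrite /= U_twists twist_pairwise.
- by rewrite /= V_twists twist_pairwise.
- move=> x y; rewrite !inE => /orP[/eqP ->|/mapP[x' x'le ->]].
    by case/orP=> [/eqP -> //|/mapP[y' _ ->]]; exact: U_twist.
  case/orP=> [/eqP ->|/mapP[y' y'lf ->]]; last exact/twist_anticommute/lef.
  by rewrite anticommuteC; exact: V_twist.
- move=> x; rewrite inE => /orP[/eqP -> //|/mapP[y yle ->]].
  rewrite (twist_sqr V2' (b := 1)) ?le1 ?scale1r // mulr1 opprK.
  by rewrite scale1r.
move=> x; rewrite inE => /orP[/eqP -> //|/mapP[y ylf ->]].
rewrite (twist_sqr V2' (b := -1)) ?lf1 ?scaleN1r // mulrNN mulr1.
by rewrite scaleN1r.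
Qed.

(** Here [- V ^+ 2 = -1], so the twisted [le] and [lf] trade places, and both [U] and [V] join the
    elements of square [1]. *)
Lemma geom_type_double_swap p q :
  V ^+ 2 = 1 -> geom_type p q B -> geom_type q.+2 p C.
Proof.
move=> V2 [le [lf [<- <- /clifford_systemP[[ple plf lef] [le1 lf1]] gen]]].
have V2' : V ^+ 2 = 1 *: 1 by rewrite V2 scale1r.
exists (U :: V :: map twist lf), (map twist le).
split; rewrite /= ?size_map //; last first.
  move=> c; apply: (twist_gen V2') gen c => [|||x].
  - by rewrite expr2 mulr1.
  - exact: mem_head.
  - by rewrite !in_cons eqxx !orbT.
  by rewrite mem_cat => /orP[] xl; rewrite !in_cons mem_cat (map_f _ xl) ?orbT.
apply/clifford_systemP; split; [split|split].
- by rewrite /= UV U_twists V_twists twist_pairwise.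
- by rewrite twist_pairwise.
- move=> x _ + /mapP[y yle ->].
  rewrite !inE => /or3P[/eqP ->|/eqP ->|/mapP[x' x'lf ->]].
  - exact: U_twist.
  - exact: V_twist.
  by apply: twist_anticommute; rewrite anticommuteC; exact: lef.
- move=> x; rewrite !inE => /or3P[/eqP -> //|/eqP -> //|/mapP[y ylf ->]].
  rewrite (twist_sqr V2' (b := -1)) ?lf1 ?scaleN1r // mul1r opprK.
  by rewrite scale1r.
move=> _ /mapP[y yle ->].
by rewrite (twist_sqr V2' (b := 1)) ?le1 ?scale1r // mul1r scaleN1r.
Qed.

End Doubling.

(** * Multiplication by the product of four generators *)

(** One sign fewer than in [anticommute_prod], because [x] commutes with its own occurrence in
    [l]. *)
Lemma anticommute_prod_mem (B : pzRingType) (x : B) (l : seq B) :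
  pairwise (@anticommute B) l -> x \in l ->
  (\prod_(y <- l) y) * x = (-1) ^+ (size l).-1 * (x * \prod_(y <- l) y).
Proof.
elim: l => // y l IHl /= /andP[yl /IHl{}IHl]; rewrite big_cons -mulrA.
have [-> _|x'y] := eqVneq x y.
  by rewrite anticommute_prod // !mulrA (commr_sign y).
rewrite inE (negPf x'y) => /= xl; rewrite IHl //.
(* [l] contains [x], so it is nonempty and the predecessor of its size is not truncated at [0]. *)
have ->: size l = (size l).-1.+1 by case: (l) xl.
have /eqP xy := allP yl _ xl.
rewrite (mulrA y) (commr_sign y) -mulrA (mulrA y) xy.
by rewrite exprS mulN1r !mulNr mulrN -!mulrA.
Qed.

(* Multiplication by [w], the product of the four generators, negates the
   squares of those generators, as [w] anticommutes with each of them. *)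
Lemma geom_type_four (R : comNzRingType) (B : algType R) q :
  geom_type 4 q B -> geom_type 0 (q + 4) B.
Proof.
case=> le [lf [sle <- /clifford_systemP[[ple plf lef] [le1 lf1]] gen]].
pose w := \prod_(x <- le) x.
(* The sign is [+1] because ['C(4, 2) = 6] is even. *)
have w2 : w * w = 1.
  have := @clifford_prod_sqr _ le [::]; rewrite cats0 sle /= expr2 => -> //.
    by rewrite addn0 -signr_odd expr0.
  by apply/clifford_systemP; split.
(* An element of [le] crosses three other factors, an odd number. An element of [lf] crosses four,
   so it commutes with [w] and can be kept unchanged. *)
have wle x : x \in le -> w * x = - (x * w).
  move=> xle; rewrite /w anticommute_prod_mem // sle /=.
  by rewrite -signr_odd expr1 mulN1r.
have wlf y : y \in lf -> w * y = y * w.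
  move=> ylf; rewrite /w anticommute_prod ?sle.
    by rewrite -signr_odd expr0 mul1r.
  by apply/allP => x xle; rewrite anticommuteC; exact: lef.
have xw y x : y \in le -> x * w * (y * w) = - (x * y).
  by move=> yle; rewrite mulrA -(mulrA x) wle // mulrN mulNr -!mulrA w2 mulr1.
exists [::], (lf ++ [seq x * w | x <- le]).
split; rewrite ?size_cat ?size_map ?sle //=.
- apply/clifford_systemP; split; [split|split] => //.
    rewrite pairwise_cat plf /= pairwise_map; apply/andP; split.
      apply/allrelP => y _ ylf /mapP[x xle ->]; rewrite /anticommute -mulrA.
      have /eqP xy := lef _ _ xle ylf.
      by rewrite wlf // (mulrA x) xy mulNr opprK mulrA.
    apply: (sub_in_pairwise (P := mem le)) ple; last exact/allP.
    by move=> x y xle yle /eqP xy; rewrite /anticommute /= !xw // xy.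
  move=> y; rewrite mem_cat => /orP[/lf1 //|/mapP[x xle ->]].
  by rewrite expr2 xw // -expr2 le1.
- move=> b; apply: alg_gen_trans (gen b) => x.
  set T := fun x => _; have Tle y : y \in le -> alg_gen T (y * w).
    move=> yle; apply: alg_gen_in; rewrite /T mem_cat orbC.
    by rewrite (map_f (fun x => x * w) yle).
  rewrite mem_cat => /orP[xle|xlf]; last first.
    by apply: alg_gen_in; rewrite /T mem_cat xlf.
  (* The product of the four new generators is [(- (x1 * x2)) * (- (x3 * x4)) = w]. So [w] is
     generated, and each old [x] returns as [x * w * w]. *)
  have Tw : alg_gen T w.
    have [x1 [x2 [x3 [x4 leE]]]] : exists x1 x2 x3 x4, le = [:: x1; x2; x3; x4].
      case: (le) sle => // x1 [//|x2 [//|x3 [//|x4 []//]]] _.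
      by exists x1, x2, x3, x4.
    have inle y : y \in [:: x1; x2; x3; x4] -> y \in le by rewrite leE.
    have -> : w = x1 * w * (x2 * w) * (x3 * w * (x4 * w)).
      rewrite !xw ?inle ?inE ?eqxx ?orbT // mulrNN /w leE !big_cons big_nil.
      by rewrite mulr1 !mulrA.
    by do 2!apply: alg_gen_mul; apply: Tle; rewrite inle // !inE eqxx ?orbT.
  by rewrite -[x]mulr1 -w2 mulrA; apply: alg_gen_mul => //; exact: Tle.
Qed.

(** Relations and generation both survive a surjective morphism; this serves to pass from [A] to its
    [1]-by-[1] matrices. *)
Lemma geom_type_surj (R : comNzRingType) (B C : algType R)
    (phi : {lrmorphism B -> C}) p q :
  (forall c, exists b, phi b = c) -> geom_type p q B -> geom_type p q C.
Proof.
move=> surj [le [lf [<- <- /clifford_systemP[[ple plf lef] [le1 lf1]] gen]]].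
exists (map phi le), (map phi lf); split; rewrite ?size_map //; last first.
  move=> c; have [b <-] := surj c; apply: alg_gen_img (gen b) => x xl.
  by apply: alg_gen_in; rewrite -map_cat map_f.
have phia x y : anticommute x y -> anticommute (phi x) (phi y).
  by move=> /eqP xy; rewrite /anticommute -!rmorphM xy rmorphN.
apply/clifford_systemP; split; [split|split].
- by rewrite pairwise_map; apply: sub_pairwise ple.
- by rewrite pairwise_map; apply: sub_pairwise plf.
- by move=> _ _ /mapP[x xl ->] /mapP[y yl ->]; apply/phia/lef.
- by move=> _ /mapP[x xl ->]; rewrite -rmorphXn le1 ?rmorph1.
- by move=> _ /mapP[x xl ->]; rewrite -rmorphXn lf1 ?rmorphN1.
Qed.

(** * Matrix algebras as doublings of smaller matrix algebras *)

Section MatDouble.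
Variables (R : numFieldType) (A : algType R) (k : nat).
Local Notation n := k.+1.
Local Notation M := (matAlg n A).
Local Notation M2 := (matAlg (n + n) A).

(** The blocks are typed in [matAlg], so that its ring operations and scaling by [R] apply to them.
    As [n] is a successor, [(n + n).-1.+1] reduces to [n + n]. *)
Definition block (X Y Z T : M) : M2 := @block_mx A n n n n X Y Z T.

Lemma blockM X Y Z T X' Y' Z' T' :
  block X Y Z T * block X' Y' Z' T' =
  block (X * X' + Y * Z') (X * Y' + Y * T')
        (Z * X' + T * Z') (Z * Y' + T * T').
Proof. exact: (@mulmx_block A n n n n n n). Qed.

Lemma blockD X Y Z T X' Y' Z' T' :
  block X Y Z T + block X' Y' Z' T' = block (X + X') (Y + Y') (Z + Z') (T + T').
Proof. exact: (@add_block_mx A n n n n). Qed.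

Lemma blockN X Y Z T : - block X Y Z T = block (- X) (- Y) (- Z) (- T).
Proof. exact: (@opp_block_mx A n n n n). Qed.

Lemma block1 : block 1 0 0 1 = 1.
Proof. exact: (esym (@scalar_mx_block A n n 1)). Qed.

Lemma blockZ (c : R) X Y Z T :
  c *: block X Y Z T = block (c *: X) (c *: Y) (c *: Z) (c *: T).
Proof. exact: (@map_block_mx _ _ ( *:%R c) n n n n). Qed.

Lemma blockP (N : M2) : exists X Y Z T, N = block X Y Z T.
Proof.
pose N' : 'M[A]_(n + n) := N.
exists (ulsubmx N'), (ursubmx N'), (dlsubmx N'), (drsubmx N').
exact: (esym (submxK N')).
Qed.

Definition block_diag (X : M) : M2 := block X 0 0 X.

Fact block_diag_zmod : zmod_morphism block_diag.
Proof. by move=> X Y; rewrite /block_diag blockN blockD oppr0 addr0. Qed.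
HB.instance Definition _ :=
  GRing.isZmodMorphism.Build M M2 block_diag block_diag_zmod.

Fact block_diag_monoid : monoid_morphism block_diag.
Proof.
split=> [|X Y]; first exact: block1.
by rewrite /block_diag blockM !mulr0 !mul0r !addr0 !add0r.
Qed.
HB.instance Definition _ :=
  GRing.isMonoidMorphism.Build M M2 block_diag block_diag_monoid.

Fact block_diag_scalable : scalable block_diag.
Proof. by move=> c X; rewrite /block_diag blockZ scaler0. Qed.
HB.instance Definition _ :=
  GRing.isScalable.Build R M M2 *:%R block_diag block_diag_scalable.

(** One pair of matrices covers both doublings: [V v] has square [v], used with [v = -1] and
    [v = 1]. *)
Let U : M2 := block 1 0 0 (-1).
Let V (v : R) : M2 := block 0 1 (v *: 1) 0.

Let simpb := (@mulr0 M, @mul0r M, @addr0 M, @add0r M, @mul1r M, @mulr1 M,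
  @mulrN M, @mulNr M, @oppr0 M, @opprK M).

Let UV v : anticommute U (V v).
Proof. by apply/eqP; rewrite !blockM blockN !simpb. Qed.

Let U2 : U ^+ 2 = 1.
Proof. by rewrite expr2 blockM !simpb block1. Qed.

Let V2 v : V v ^+ 2 = v *: 1.
Proof. by rewrite expr2 blockM !simpb -block1 blockZ scaler0. Qed.

Let diagU X : GRing.comm U (block_diag X).
Proof. by rewrite /GRing.comm !blockM !simpb. Qed.

Let diagV v X : GRing.comm (V v) (block_diag X).
Proof.
by rewrite /GRing.comm !blockM !simpb -scalerAl mul1r -scalerAr mulr1.
Qed.

Let diag_span (v : R) : v ^+ 2 = 1 -> forall N : M2, exists X1 X2 X3 X4,
  N = block_diag X1 + block_diag X2 * U + block_diag X3 * V v
      + block_diag X4 * (U * V v).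
Proof.
move=> v2 N; have [X [Y [Z [T ->]]]] := blockP N.
pose h : R := 2^-1.
have hD (W W' : M) : h *: (W + W') + h *: (W - W') = W.
  by rewrite -scalerDr addrACA subrr addr0 scalerDr -scalerDl -[h]mul1r -splitr
    scale1r.
have hB (W W' : M) : h *: (W + W') - h *: (W - W') = W'.
  by rewrite -scalerN opprB [W + W']addrC [W' - W]addrC -[RHS](hD W' W)
    [- W + W']addrC.
(* The diagonal blocks require [X1 + X2 = X] and [X1 - X2 = T]. The others require [X3 + X4 = Y] and
   [v *: (X3 - X4) = Z], where [v] is its own inverse. *)
exists (h *: (X + T)), (h *: (X - T)), (h *: (Y + v *: Z)), (h *: (Y - v *: Z)).
rewrite !blockM !simpb !blockD !simpb -!scalerAr !mulr1.
by rewrite hD hD hB -scalerBr hB scalerA -expr2 v2 scale1r.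
Qed.

Lemma geom_type_mat_double p q :
  geom_type p q M -> geom_type p.+1 q.+1 M2.
Proof.
apply: (geom_type_double (UV (-1)) U2 diagU (diagV (-1)) (diag_span _)).
  by rewrite expr2 mulrNN mulr1.
by rewrite V2 scaleN1r.
Qed.

Lemma geom_type_mat_double_swap p q :
  geom_type p q M -> geom_type q.+2 p M2.
Proof.
apply: (geom_type_double_swap (UV 1) U2 diagU (diagV 1) (diag_span _)).
  by rewrite expr2 mulr1.
by rewrite V2 scale1r.
Qed.

End MatDouble.

(** Lets the base algebras enter the matrix recursion, as matrices of size [1]. *)
Lemma geom_type_mat1 (R : comNzRingType) (A : algType R) p q :
  geom_type p q A -> geom_type p q (matAlg 1 A).
Proof.
pose phi (x : A) : matAlg 1 A := const_mx x.
have phi_zmod : zmod_morphism phi.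
  by move=> x y; apply/matrixP => i j; rewrite !mxE.
have phi_mon : monoid_morphism phi.
  split=> [|x y]; apply/matrixP => i j; first by rewrite !mxE !ord1 eqxx.
  by rewrite !mxE big_ord1 !mxE.
have phi_scal : scalable phi by move=> c x; apply/matrixP => i j; rewrite !mxE.
pose mf := GRing.isZmodMorphism.Build A (matAlg 1 A) phi phi_zmod.
pose mm := GRing.isMonoidMorphism.Build A (matAlg 1 A) phi phi_mon.
pose ms := GRing.isScalable.Build R A (matAlg 1 A) *:%R phi phi_scal.
pose psi : {lrmorphism A -> matAlg 1 A} := HB.pack phi mf mm ms.
apply: (geom_type_surj (phi := psi)) => N; exists (N ord0 ord0).
by apply/matrixP => i j; rewrite !mxE !ord1.
Qed.

(** * Lower bounds for the dimensions *)

Lemma dim_geq_reg (R : fieldType) : dim_geq R^o 1.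
Proof. by exists R^o => //; exists idfun => v; exists v. Qed.

Lemma dim_geq_dbl (R : fieldType) (A : algType R) d :
  dim_geq A d -> dim_geq (dblAlg A) (d + d).
Proof.
case=> V dV [f surj]; exists (V * V)%type; first by rewrite -{1 2}dV.
pose g (x : dblAlg A) : V * V := (f x.1, f x.2).
have g_lin : linear g.
  by move=> c x y; rewrite /g /= !linearP.
pose mg := GRing.isLinear.Build R _ _ _ g g_lin.
pose h : {linear dblAlg A -> (V * V)%type} := HB.pack g mg.
exists h => -[v w]; have [x <-] := surj v; have [y <-] := surj w.
by exists (x, y).
Qed.

Lemma dim_geq_complex (R : fieldType) : dim_geq (Rcomplex R) 2.
Proof.
exists (R^o * R^o)%type => //.
pose g (x : Rcomplex R) : R^o * R^o := (complex.Re x, complex.Im x).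
have g_lin : linear g by move=> c [? ?] [? ?].
pose mg := GRing.isLinear.Build R _ _ _ g g_lin.
pose h : {linear Rcomplex R -> (R^o * R^o)%type} := HB.pack g mg.
by exists h => -[v w]; exists (Complex v w).
Qed.

Lemma dim_geq_quat (R : fieldType) : dim_geq (quat R) 4.
Proof.
exists (R^o * R^o * R^o * R^o)%type => //.
pose g (x : quat R) : R^o * R^o * R^o * R^o := quat_tuple x.
have g_lin : linear g by move=> c [? ? ? ?] [? ? ? ?].
pose mg := GRing.isLinear.Build R _ _ _ g g_lin.
pose h : {linear quat R -> (R^o * R^o * R^o * R^o)%type} := HB.pack g mg.
by exists h => -[[[a b] c] d]; exists (Quat a b c d).
Qed.

Lemma dim_geq_mat (R : fieldType) (A : algType R) (k d : nat) :
  dim_geq A d -> dim_geq (matAlg k.+1 A) (k.+1 * k.+1 * d).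
Proof.
case=> V dV [f surj]; exists {ffun 'I_k.+1 * 'I_k.+1 -> V}.
  by rewrite -dV -[in RHS](card_ord k.+1) -card_prod.
pose g (N : matAlg k.+1 A) : {ffun 'I_k.+1 * 'I_k.+1 -> V} :=
  [ffun ij => f (N ij.1 ij.2)].
have g_lin : linear g.
  by move=> c X Y; apply/ffunP => -[i j]; rewrite !ffunE /= !mxE linearP.
pose mg := GRing.isLinear.Build R _ _ _ g g_lin.
pose h : {linear matAlg k.+1 A -> {ffun 'I_k.+1 * 'I_k.+1 -> V}} :=
  HB.pack g mg.
(* Preimages under [f] are chosen so that all entries of a matrix can be lifted at once. *)
exists h => v; have {}surj w : {b | f b == w}.
  by apply: sigW; have [b <-] := surj w; exists b.
exists (\matrix_(i, j) sval (surj (v (i, j)))).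
by apply/ffunP => -[i j]; rewrite !ffunE /= !mxE; case: (surj _) => b /= /eqP.
Qed.

(** * Generators of the base algebras *)

Lemma geom_type_reg (R : comNzRingType) : geom_type 0 0 R^o.
Proof.
exists [::], [::]; split=> // b; rewrite -[b]mulr1.
exact/(@alg_gen_scale _ R^o)/alg_gen_1.
Qed.

Lemma geom_type_complex (R : fieldType) : geom_type 0 1 (Rcomplex R).
Proof.
pose u : Rcomplex R := Complex 0 1; exists [::], [:: u]; split=> //.
  by rewrite /clifford_system /= !andbT; apply/eqP; congr Complex; ring.
set T := fun x => _ => -[a b].
have -> : Complex a b = a *: (1 : Rcomplex R) + b *: u.
  by congr Complex; ring.
apply: alg_gen_add; apply: alg_gen_scale; first exact: alg_gen_1.
by apply: alg_gen_in; rewrite /T inE.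
Qed.

Lemma quat_gen (R : comNzRingType) (T : quat R -> Prop) :
  alg_gen T (Quat 0 1 0 0) -> alg_gen T (Quat 0 0 1 0) -> forall x, alg_gen T x.
Proof.
move=> Ti Tj [a b c d].
have -> : Quat a b c d
    = a *: (1 : quat R) + b *: Quat 0 1 0 0 + c *: Quat 0 0 1 0
    + d *: (Quat 0 1 0 0 * Quat 0 0 1 0).
  by congr Quat; ring.
have T1 := alg_gen_1 T.
by do ?[apply: alg_gen_add | apply: alg_gen_scale | apply: alg_gen_mul].
Qed.

Lemma geom_type_quat (R : comNzRingType) : geom_type 0 2 (quat R).
Proof.
pose u : quat R := Quat 0 1 0 0; pose v : quat R := Quat 0 0 1 0.
exists [::], [:: u; v]; split=> //.
  rewrite /clifford_system /= !andbT.
  by apply/and3P; split; apply/eqP; congr Quat; ring.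
by apply: quat_gen; apply: alg_gen_in; rewrite !inE eqxx ?orbT.
Qed.

Lemma dbl_gen (R : numFieldType) (A : algType R) (T : dblAlg A -> Prop) :
  (forall x : A, alg_gen T (x, x)) -> alg_gen T (1, -1) ->
  forall z, alg_gen T z.
Proof.
move=> diagT T1 [x y]; pose h : R := 2^-1.
have hh (z : A) : h *: z + h *: z = z.
  by rewrite -scalerDl -[h]mul1r -splitr scale1r.
(* Half the sum on the diagonal, plus half the difference times [(1, -1)]. *)
have -> : (x, y) = (h *: (x + y), h *: (x + y))
    + (h *: (x - y), h *: (x - y)) * (1, -1) :> dblAlg A.
  apply: injective_projections => /=.
    by rewrite mulr1 -scalerDr addrACA subrr addr0 scalerDr hh.
  rewrite mulrN1 -scalerBr opprB [x + y]addrC addrACA subrr addr0.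
  by rewrite scalerDr hh.
by apply: alg_gen_add => //; apply: alg_gen_mul.
Qed.

Lemma geom_type_dbl_reg (R : numFieldType) : geom_type 1 0 (dblAlg R^o).
Proof.
pose u : dblAlg R^o := (1, -1); exists [:: u], [::]; split=> //.
  rewrite /clifford_system /= /u !andbT; apply/eqP.
  by rewrite expr2; congr pair; rewrite /= ?mulrNN mulr1.
apply: dbl_gen => [x|]; last by apply: alg_gen_in; rewrite inE.
have -> : (x, x) = x *: 1 :> dblAlg R^o by congr pair; rewrite /= [RHS]mulr1.
exact/alg_gen_scale/alg_gen_1.
Qed.

Section Diagonal.
Variables (R : comNzRingType) (A : algType R).

Definition dbl_diag (x : A) : dblAlg A := (x, x).

Fact dbl_diag_zmod : zmod_morphism dbl_diag. Proof. by []. Qed.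
HB.instance Definition _ :=
  GRing.isZmodMorphism.Build A (dblAlg A) dbl_diag dbl_diag_zmod.

Fact dbl_diag_monoid : monoid_morphism dbl_diag. Proof. by []. Qed.
HB.instance Definition _ :=
  GRing.isMonoidMorphism.Build A (dblAlg A) dbl_diag dbl_diag_monoid.

Fact dbl_diag_scalable : scalable dbl_diag. Proof. by []. Qed.
HB.instance Definition _ :=
  GRing.isScalable.Build R A (dblAlg A) *:%R dbl_diag dbl_diag_scalable.

Lemma dbl_mulE (x1 x2 y1 y2 : A) :
  ((x1, x2) : dblAlg A) * (y1, y2) = (x1 * y1, x2 * y2).
Proof. by []. Qed.

Lemma dbl_oppE (x1 x2 : A) : - ((x1, x2) : dblAlg A) = (- x1, - x2).
Proof. by []. Qed.

End Diagonal.

(** The sign in [w = (k, - k)] separates the two factors: [(k, k)] is the product of the first two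
    generators, and [- ((k, k) * w) = (1, -1)], which is what [dbl_gen] asks for besides the
    diagonal. *)
Lemma geom_type_dbl3 (R : numFieldType) (A : algType R) (i j : A) :
  i * j = - (j * i) -> i * i = -1 -> j * j = -1 ->
  (forall T : A -> Prop, T i -> T j -> forall x, alg_gen T x) ->
  geom_type 0 3 (dblAlg A).
Proof.
move=> ij i2 j2 genA; pose k := i * j; pose w : dblAlg A := (k, - k).
have ji : j * i = - k by rewrite /k ij opprK.
have ik : i * k = - j by rewrite mulrA i2 mulN1r.
have ki : k * i = j by rewrite -mulrA ji mulrN ik opprK.
have kj : k * j = - i by rewrite -mulrA j2 mulrN1.
have jk : j * k = i by rewrite mulrA ji mulNr kj opprK.
have k2 : k * k = -1 by rewrite -{1}[k]opprK -ji mulNr -mulrA ik mulrN j2 opprK.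
exists [::], [:: dbl_diag i; dbl_diag j; w]; split=> //.
  rewrite /clifford_system /= !andbT /anticommute /dbl_diag /w !expr2.
  rewrite !dbl_mulE !dbl_oppE !mulrN !mulNr !opprK.
  by rewrite -/k ji ik ki jk kj i2 j2 k2 !opprK !eqxx.
set T := fun x => _.
have Ti : alg_gen T (dbl_diag i) by apply/alg_gen_in/mem_head.
have Tj : alg_gen T (dbl_diag j).
  by apply: alg_gen_in; rewrite /T /= 2!in_cons eqxx orbT.
have Tw : alg_gen T w.
  by apply: alg_gen_in; rewrite /T /= 3!in_cons eqxx !orbT.
have Tdiag x : alg_gen T (dbl_diag x).
  apply: (alg_gen_img (phi := @dbl_diag R A) (S := fun x => x = i \/ x = j)).
    by move=> y [->|->].
  by apply: genA; [left|right].
apply: dbl_gen => //.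
have -> : (1, -1) = - (dbl_diag k * w) :> dblAlg A.
  by rewrite dbl_mulE dbl_oppE mulrN k2 !opprK.
exact/alg_gen_opp/alg_gen_mul.
Qed.

Lemma geom_type_dbl_quat (R : numFieldType) : geom_type 0 3 (dblAlg (quat R)).
Proof.
apply: (@geom_type_dbl3 _ _ (Quat 0 1 0 0) (Quat 0 0 1 0)).
- by congr Quat; ring.
- by congr Quat; ring.
- by congr Quat; ring.
- by move=> T Ti Tj; apply: quat_gen; exact: alg_gen_in.
Qed.

(** * Sign of the pseudoscalar and the classification table *)

Lemma pseudoscalar_sign (p q : nat) : (p + q <= 7)%N ->
  (p%:Z - q%:Z \in [:: 5; 4; 1; 0; -3; -4; -7] -> ~~ odd ('C(p + q, 2) + q)) /\
  (p%:Z - q%:Z \in [:: 7; 6; 3; 2; -1; -2; -5; -6] -> odd ('C(p + q, 2) + q)).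
Proof.
(* Values of [p] or [q] from [8] on contradict the bound; each remaining pair is decided by
   computation. *)
by do 8?[case: p => [|p]]; do 8?[case: q => [|q]].
Qed.

Lemma geomAlg_isom_mat (R : fieldType) (A : algType R) (d k p q : nat) :
  dim_geq A d -> geom_type p q (matAlg k.+1 A) ->
  (k.+1 * k.+1 * d = 2 ^ (p + q))%N -> 'G[R]_(p, q) ≅ matAlg k.+1 A.
Proof.
by move=> dA /geomAlg_isom isoA e; apply: isoA; rewrite -e; exact: dim_geq_mat.
Qed.

Local Notation up := geom_type_mat_double.
Local Notation swap := geom_type_mat_double_swap.

Theorem mainTheorem1 (R : realType) :
  (
  ('G[R]_(0, 0) ≅ R^o) /\
  ('G[R]_(1, 0) ≅ dblAlg R^o /\
   'G[R]_(0, 1) ≅ (Rcomplex R)) /\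
  ('G[R]_(2, 0) ≅ matAlg 2 R^o /\
   'G[R]_(1, 1) ≅ matAlg 2 R^o /\
   'G[R]_(0, 2) ≅ (quat R)) /\
  ('G[R]_(3, 0) ≅ matAlg 2 (Rcomplex R) /\
   'G[R]_(2, 1) ≅ matAlg 2 (dblAlg R^o) /\
   'G[R]_(1, 2) ≅ matAlg 2 (Rcomplex R) /\
   'G[R]_(0, 3) ≅ dblAlg (quat R)) /\
  ('G[R]_(4, 0) ≅ matAlg 2 (quat R) /\
   'G[R]_(3, 1) ≅ matAlg 4 R^o /\
   'G[R]_(2, 2) ≅ matAlg 4 R^o /\
   'G[R]_(1, 3) ≅ matAlg 2 (quat R) /\
   'G[R]_(0, 4) ≅ matAlg 2 (quat R)) /\
  ('G[R]_(5, 0) ≅ matAlg 2 (dblAlg (quat R)) /\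
   'G[R]_(4, 1) ≅ matAlg 4 (Rcomplex R) /\
   'G[R]_(3, 2) ≅ matAlg 4 (dblAlg R^o) /\
   'G[R]_(2, 3) ≅ matAlg 4 (Rcomplex R) /\
   'G[R]_(1, 4) ≅ matAlg 2 (dblAlg (quat R)) /\
   'G[R]_(0, 5) ≅ matAlg 4 (Rcomplex R)) /\
  ('G[R]_(6, 0) ≅ matAlg 4 (quat R) /\
   'G[R]_(5, 1) ≅ matAlg 4 (quat R) /\
   'G[R]_(4, 2) ≅ matAlg 8 R^o /\
   'G[R]_(3, 3) ≅ matAlg 8 R^o /\
   'G[R]_(2, 4) ≅ matAlg 4 (quat R) /\
   'G[R]_(1, 5) ≅ matAlg 4 (quat R) /\
   'G[R]_(0, 6) ≅ matAlg 8 R^o) /\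
  ('G[R]_(7, 0) ≅ matAlg 8 (Rcomplex R) /\
   'G[R]_(6, 1) ≅ matAlg 4 (dblAlg (quat R)) /\
   'G[R]_(5, 2) ≅ matAlg 8 (Rcomplex R) /\
   'G[R]_(4, 3) ≅ matAlg 8 (dblAlg R^o) /\
   'G[R]_(3, 4) ≅ matAlg 8 (Rcomplex R) /\
   'G[R]_(2, 5) ≅ matAlg 4 (dblAlg (quat R)) /\
   'G[R]_(1, 6) ≅ matAlg 8 (Rcomplex R) /\
   'G[R]_(0, 7) ≅ matAlg 8 (dblAlg R^o))) /\
  (forall p q : nat, (p + q <= 7)%N ->
    (p%:Z - q%:Z \in [:: 5; 4; 1; 0; -3; -4; -7] ->
      pseudoscalar R p q ^+ 2 = 1) /\
    (p%:Z - q%:Z \in [:: 7; 6; 3; 2; -1; -2; -5; -6] ->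
      pseudoscalar R p q ^+ 2 = -1)).

Proof.
split; last first.
  move=> p q /pseudoscalar_sign[even_pq odd_pq]; rewrite pseudoscalar_sqr.
  by rewrite -signr_odd; split=> [/even_pq/negPf -> | /odd_pq ->].
have t00 := geom_type_mat1 (geom_type_reg R).
have t10 := geom_type_mat1 (geom_type_dbl_reg R).
have t01 := geom_type_mat1 (geom_type_complex R).
have t02 := geom_type_mat1 (geom_type_quat R).
have t03 := geom_type_mat1 (geom_type_dbl_quat R).
(* [swap] takes type [(0, q)] to [(q + 2, 0)]. *)
have t20 := swap t00.
have t30 := swap t01.
have t40 := swap t02.
have t50 := swap t03.
(* Types [(4, 0)] to [(4, 3)] give [(0, 4)] to [(0, 7)]; swapping [(0, 4)] and [(0, 5)] gives
   [(6, 0)] and [(7, 0)]. *)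
have t04 := geom_type_four t40.
have t41 := up t30.
have t05 := geom_type_four t41.
have t60 := swap t04.
have t70 := swap t05.
have t42 := up (up t20).
have t06 := geom_type_four t42.
have t43 := up (up (up t10)).
have t07 := geom_type_four t43.
have dR := dim_geq_reg R.
have dRR := dim_geq_dbl dR.
have dC := dim_geq_complex R.
have dH := dim_geq_quat R.
have dHH := dim_geq_dbl dH.
split; first exact: geomAlg_isom (geom_type_reg R) dR.
split; first split.
- exact: geomAlg_isom (geom_type_dbl_reg R) dRR.
- exact: geomAlg_isom (geom_type_complex R) dC.
split; first do !apply: conj.
(* The doubled sizes are convertible to the numerals of the table; the hole is the dimension count,
   closed by computation. *)
- by refine (geomAlg_isom_mat dR t20 _).
- by refine (geomAlg_isom_mat dR (up t00) _).
- exact: geomAlg_isom (geom_type_quat R) dH.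
split; first do !apply: conj.
- by refine (geomAlg_isom_mat dC t30 _).
- by refine (geomAlg_isom_mat dRR (up t10) _).
- by refine (geomAlg_isom_mat dC (up t01) _).
- exact: geomAlg_isom (geom_type_dbl_quat R) dHH.
split; first do !apply: conj.
- by refine (geomAlg_isom_mat dH t40 _).
- by refine (geomAlg_isom_mat dR (up t20) _).
- by refine (geomAlg_isom_mat dR (up (up t00)) _).
- by refine (geomAlg_isom_mat dH (up t02) _).
- by refine (geomAlg_isom_mat dH t04 _).
split; first do !apply: conj.
- by refine (geomAlg_isom_mat dHH t50 _).
- by refine (geomAlg_isom_mat dC t41 _).
- by refine (geomAlg_isom_mat dRR (up (up t10)) _).
- by refine (geomAlg_isom_mat dC (up (up t01)) _).
- by refine (geomAlg_isom_mat dHH (up t03) _).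
- by refine (geomAlg_isom_mat dC t05 _).
split; first do !apply: conj.
- by refine (geomAlg_isom_mat dH t60 _).
- by refine (geomAlg_isom_mat dH (up t40) _).
- by refine (geomAlg_isom_mat dR t42 _).
- by refine (geomAlg_isom_mat dR (up (up (up t00))) _).
- by refine (geomAlg_isom_mat dH (up (up t02)) _).
- by refine (geomAlg_isom_mat dH (up t04) _).
- by refine (geomAlg_isom_mat dR t06 _).
do !apply: conj.
- by refine (geomAlg_isom_mat dC t70 _).
- by refine (geomAlg_isom_mat dHH (up t50) _).
- by refine (geomAlg_isom_mat dC (up (up t30)) _).
- by refine (geomAlg_isom_mat dRR t43 _).
- by refine (geomAlg_isom_mat dC (up (up (up t01))) _).
- by refine (geomAlg_isom_mat dHH (up (up t03)) _).
- by refine (geomAlg_isom_mat dC (up t05) _).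
- by refine (geomAlg_isom_mat dRR t07 _).
Qed.
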